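(* Let $n$, $k$ and $l$ be integers with $1\leq k<l\leq n-1$ and $k+l\leq n$, and let $G(n,k,l)$ be the set-inclusion graph. Then the spectrum of $G(n,k,l)$ (the multiset of eigenvalues of its adjacency matrix) is $$ \left\{\left[\pm\sqrt{\beta_s}\right]^{\binom{n}{s}-\binom{n}{s-1}}\mid 0\leq s\leq k\right\}\cup \left\{\left[0\right]^{\binom{n}{l}-\binom{n}{k}}\right\}, $$ where for $0\le s\le k$, $$ \beta_s=\sum_{i=\max\{2k-l,0\}}^{k}\binom{n-2k+i}{l-2k+i}\cdot\left(\sum_{r=0}^s(-1)^{s-r}\binom{s}{r}\binom{k-r}{i-r}\binom{n-k-s+r}{k-i-s+r}\right). $$
   Context: For integers $1\leq k<l\leq n-1$, the set-inclusion graph $G(n,k,l)$ is the simple graph whose vertex set consists of all $k$-subsets and all $l$-subsets of $[n]=\{1,\dots,n\}$, two distinct vertices being adjacent iff one of them is contained in the other. The notation $[\lambda]^m$ means the eigenvalue $\lambda$ with multiplicity $m$, $[\pm\mu]^m$ means both $\mu$ and $-\mu$ each with multiplicity $m$, and the union is a union of multisets. Binomial coefficients $\binom{a}{b}$ are $0$ when $b<0$ or $b>a\ge 0$; in particular $\binom{n}{-1}=0$. *)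

(* Defs.v *)
From HB Require Import structures.
From mathcomp Require Import all_boot all_order all_algebra.
Set Implicit Arguments.
Unset Strict Implicit.
Unset Printing Implicit Defensive.
Import Order.TTheory GRing.Theory Num.Theory.
Local Open Scope ring_scope.

(* 0 as soon as the lower argument is negative.  The upper argument is never
   negative where binz is used, so its value there is immaterial. *)
Definition binz (a b : int) : int :=
  match a, b with
  | Posz a', Posz b' => ('C(a', b'))%:Z
  | _, _ => 0
  end.

Definition incl_vertex (n k l : nat) : finType :=
  {A : {set 'I_n} | (#|A| == k) || (#|A| == l)}.

Definition incl_adj (n k l : nat) : rel (incl_vertex n k l) :=
  fun u v => (u != v) && ((val u \subset val v) || (val v \subset val u)).

Definition adjacency_mx (C : numClosedFieldType) (V : finType) (e : rel V) :
    'M[C]_#|V| :=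
  \matrix_(i, j) (e (enum_val i) (enum_val j))%:R.

(* Eigenvalues in C with their algebraic multiplicities; a multiset, so the
   sequence is meaningful only up to perm_eq. *)
Definition spectrum (C : numClosedFieldType) (m : nat) (A : 'M[C]_m) : seq C :=
  sval (closed_field_poly_normal (char_poly A)).

Lemma char_poly_spectrum (C : numClosedFieldType) (m : nat) (A : 'M[C]_m) :
  char_poly A = \prod_(z <- spectrum A) ('X - z%:P).
Proof.
rewrite /spectrum; case: closed_field_poly_normal => r /= {1}->.
by rewrite (monicP (char_poly_monic A)) scale1r.
Qed.

(* The lower bound of i is a truncated subtraction, i.e., max(2k - l, 0). *)
Definition beta (n k l s : nat) : int :=
  \sum_((2 * k - l)%N <= i < k.+1)
    (binz (n%:Z - 2 * k%:Z + i%:Z) (l%:Z - 2 * k%:Z + i%:Z) *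
     (\sum_(0 <= r < s.+1)
        (-1) ^+ (s - r)%N * binz s%:Z r%:Z
        * binz (k%:Z - r%:Z) (i%:Z - r%:Z)
        * binz (n%:Z - k%:Z - s%:Z + r%:Z) (k%:Z - i%:Z - s%:Z + r%:Z))).

(* The binomial coefficient with lower argument -1 is 0.  The subtraction does
   not truncate when 2s <= n + 1, which covers all s <= k < n / 2. *)
Definition mult (n s : nat) : nat :=
  ('C(n, s) - (if s is s'.+1 then 'C(n, s') else 0))%N.

(* Main.v *)
(* Let W be the inclusion matrix between k-sets and l-sets. The adjacency matrix
   is [[0, W], [W^T, 0]], so its spectrum consists of the two square roots of
   each eigenvalue of W W^T, padded with zeros.

   Let T_a = D^T D, where D is the inclusion matrix from level a-1 to level a.
   Since D D^T = T_(a-1) + (n - 2a + 2) I, and D D^T and D^T D have the same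
   nonzero spectrum, induction on a shows that T_a has the eigenvalues
   (a - s)(n + 1 - s - a), 0 <= s <= a, with multiplicity C(n,s) - C(n,s-1).
   Writing j = l - k, the same commutation relation gives
     (j!)^2 W W^T = \prod_(i < j) (T_k + (i + 1)(n - 2k - i) I),
   whose value at the s-th eigenvalue of T_k factors, so that W W^T has the
   eigenvalue C(l-s, l-k) C(n-k-s, l-k). The sum defining beta_s collapses to
   this product by Vandermonde's convolution over i followed by an s-th finite
   difference over r. *)

Require Import Defs.
From HB Require Import structures.
From mathcomp Require Import all_boot all_order all_algebra perm.
From mathcomp Require Import zify ring.
Set Implicit Arguments.
Unset Strict Implicit.
Unset Printing Implicit Defensive.
Import Order.TTheory GRing.Theory Num.Theory.
Local Open Scope ring_scope.

(** * Characteristic polynomials *)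

(** Clear [B] from the block matrix [[x, A], [B, 1]], once by a right factor and once by a left
    factor that scales the lower rows by [x]. Nothing is inverted, so [x] may be the indeterminate
    ['X]. *)
Lemma det_scalar_sub_mulmxC (R : comNzRingType) (x : R) m n
    (A : 'M[R]_(m, n)) (B : 'M_(n, m)) :
  x ^+ n * \det (x%:M - A *m B) = x ^+ m * \det (x%:M - B *m A).
Proof.
pose M := block_mx x%:M A B 1%:M.
have detMr : \det (M *m block_mx 1%:M 0 (- B) 1%:M) = \det (x%:M - A *m B).
  rewrite mulmx_block !mulmx1 !mulmx0 !mulmxN !mul1mx add0r subrr add0r.
  by rewrite det_ublock det1 mulr1.
have detMl : \det (block_mx 1%:M 0 (- B) x%:M *m M) = x ^+ m * \det (x%:M - B
  *m A).
  rewrite mulmx_block !mul1mx !mul0mx !addr0 !mulNmx !mulmx1.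
  by rewrite mul_mx_scalar mul_scalar_mx addrC subrr det_ublock det_scalar
    addrC.
rewrite -detMl -detMr !det_mulmx !det_lblock !det1 det_scalar.
by rewrite !mul1r !mulr1.
Qed.

Lemma det_scalar_antidiag (R : comNzRingType) (x : R) m n
    (A : 'M[R]_(m, n)) (B : 'M_(n, m)) :
  x ^+ m * \det (block_mx x%:M (- A) (- B) x%:M)
  = x ^+ n * \det ((x ^+ 2)%:M - A *m B).
Proof.
have detD : \det (block_mx x%:M 0 B 1%:M) = x ^+ m :> R.
  by rewrite det_lblock det1 mulr1 det_scalar.
rewrite -detD mulrC -det_mulmx mulmx_block !mulmx1 !mulmx0 !add0r.
rewrite -scalar_mxM -expr2 !mulNmx mul_mx_scalar mul_scalar_mx addNr.
by rewrite det_ublock det_scalar mulrC.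
Qed.

Lemma char_poly_mulmxC (R : comNzRingType) m n
    (A : 'M[R]_(m, n)) (B : 'M_(n, m)) :
  'X^n * char_poly (A *m B) = 'X^m * char_poly (B *m A).
Proof. by rewrite /char_poly /char_poly_mx !map_mxM det_scalar_sub_mulmxC. Qed.

(** Substituting ['X^2] replaces each eigenvalue of [A *m B] by its two square roots; the powers of
    ['X] make up for the different block sizes. *)
Lemma char_poly_antidiag (R : comNzRingType) m n
    (A : 'M[R]_(m, n)) (B : 'M_(n, m)) :
  'X^m * char_poly (block_mx 0 A B 0) = 'X^n * (char_poly (A *m B) \Po 'X^2).
Proof.
have -> : char_poly (A *m B) \Po 'X^2
    = \det ((('X : {poly R}) ^+ 2)%:M - map_mx polyC A *m map_mx polyC B).
  rewrite /char_poly -det_map_mx; congr (\det _).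
  rewrite -map_mxM; apply/matrixP => i j; rewrite !mxE /= comp_polyB comp_polyC.
  by case: eqP => _; rewrite ?mulr1n ?mulr0n ?comp_polyX ?comp_poly0.
rewrite -det_scalar_antidiag /char_poly /char_poly_mx map_block_mx !map_mx0.
by rewrite scalar_mx_block opp_block_mx add_block_mx !oppr0 !addr0 !add0r.
Qed.

Lemma char_poly_addC (R : comNzRingType) n (A : 'M[R]_n) (c : R) :
  char_poly (A + c%:M) = char_poly A \Po ('X - c%:P).
Proof.
rewrite /char_poly -det_map_mx; congr (\det _).
apply/matrixP => i j; rewrite !mxE /= comp_polyB comp_polyC.
case: eqP => _; rewrite ?mulr1n ?mulr0n ?comp_polyX ?comp_poly0 ?addr0 //.
by rewrite polyCD opprD [in RHS]addrAC addrA.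
Qed.

(** Two listings of [V] differ by a permutation, whose sign enters once for the rows and once for
    the columns. *)
Lemma char_poly_matrix_bij (R : comNzRingType) (V : finType) (F : V -> V -> R)
    m (f : 'I_m -> V) : bijective f ->
  char_poly (\matrix_(i, j) F (enum_val i) (enum_val j) : 'M_#|V|)
  = char_poly (\matrix_(i, j) F (f i) (f j)).
Proof.
move=> bij_f; have := bij_eq_card bij_f; rewrite card_ord => /esym m_eq.
case: m / m_eq f bij_f => f [g fK gK].
have s_inj : injective (fun i => enum_rank (f i)).
  by move=> i j /enum_rank_inj /(can_inj fK).
pose s := perm s_inj.
set A := (\matrix_(_, _) _ in LHS); set B := (\matrix_(_, _) _ in RHS).
have -> : char_poly B = \det (row_perm s (col_perm s (char_poly_mx A))).
  congr (\det _); apply/matrixP => i j.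
  by rewrite !mxE !permE !enum_rankK (inj_eq s_inj).
rewrite row_permE col_permE !det_mulmx !det_perm odd_permV mulrCA.
by rewrite -signr_addb addbb mulr1.
Qed.

Lemma poly_horner_inj (R : numDomainType) (p q : {poly R}) :
  (forall x, p.[x] = q.[x]) -> p = q.
Proof.
move=> eq_pq; apply/eqP; rewrite -subr_eq0; apply/eqP.
apply: (@roots_geq_poly_eq0 _ _ [seq i%:R | i <- iota 0 (size (p - q))]).
- by apply/allP => _ /mapP[i _ ->]; rewrite rootE !hornerE eq_pq subrr.
- by rewrite (map_inj_uniq (mulrIn (oner_neq0 R))) iota_uniq.
- by rewrite size_map size_iota.
Qed.

Lemma horner_char_poly (R : comNzRingType) n (A : 'M[R]_n) (x : R) :
  (char_poly A).[x] = \det (x%:M - A).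
Proof.
rewrite -[_.[x]]/(horner_eval x (char_poly A)) -det_map_mx; congr (\det _).
apply/matrixP => i j; rewrite !mxE.
by rewrite /= /horner_eval !hornerE hornerMn hornerX.
Qed.

(* Splitting q into linear factors reduces this to q = 'X - r%:P, where the
   determinant is a value of the characteristic polynomial. *)
Lemma det_horner_mx (C : closedFieldType) n (A : 'M[C]_n.+1) (q : {poly C}) s :
  char_poly A = \prod_(z <- s) ('X - z%:P) ->
  \det (horner_mx A q) = \prod_(z <- s) q.[z].
Proof.
move=> charA.
have size_s : size s = n.+1.
  by apply: succn_inj; rewrite -(size_prod_XsubC s id) -charA size_char_poly.
have det_lin r : \det (A - r%:M) = \prod_(z <- s) (z - r).
  rewrite -opprB -scaleN1r detZ -horner_char_poly charA horner_prod -size_s.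
  elim: s {charA size_s} => [|z s IHs]; first by rewrite !big_nil mulr1.
  rewrite !big_cons exprS mulrACA IHs hornerXsubC; congr (_ * _).
  by rewrite mulN1r opprB.
have [rs ->] := closed_field_poly_normal q; set a := lead_coef q.
rewrite linearZ rmorph_prod /= detZ (big_morph _ (@det_mulmx _ n.+1) (det1 _
  _)).
under eq_bigr do rewrite rmorphB /= horner_mx_X horner_mx_C det_lin.
rewrite exchange_big /= -size_s.
under [in RHS]eq_bigr do rewrite hornerZ horner_prod.
rewrite big_split /= big_const_seq count_predT iter_mulr_1; congr (_ * _).
by apply: eq_bigr => z _; apply: eq_bigr => r _; rewrite hornerXsubC.
Qed.

(** Spectral mapping: for a polynomial p and every scalar x, x - p(A) is again a polynomial in [A],
    so [det_horner_mx] gives its determinant. *)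
Lemma char_poly_prod_shifts (C : numClosedFieldType) n (A : 'M[C]_n) (a : C) cs
  s :
  char_poly A = \prod_(z <- s) ('X - z%:P) ->
  char_poly (a *: \prod_(c <- cs) (A + c%:M))
  = \prod_(z <- s) ('X - (a * \prod_(c <- cs) (z + c))%:P).
Proof.
(* [horner_mx] is applied to matrices of positive size only, so the empty matrix is treated
   apart. *)
case: n A => [|n] A charA.
  have : size (char_poly A) = 1%N by rewrite size_char_poly.
  rewrite charA size_prod_XsubC => -[/eqP]; rewrite size_eq0 => /eqP -> /=.
  by rewrite big_nil /char_poly det_mx00.
pose p := a *: \prod_(c <- cs) ('X + c%:P).
have pE z : p.[z] = a * \prod_(c <- cs) (z + c).
  rewrite hornerZ horner_prod; congr (_ * _).
  by apply: eq_bigr => c _; rewrite hornerD hornerX hornerC.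
have pA : horner_mx A p = a *: \prod_(c <- cs) (A + c%:M).
  rewrite linearZ rmorph_prod /=; congr (_ *: _).
  by apply: eq_bigr => c _; rewrite rmorphD /= horner_mx_X horner_mx_C.
apply: poly_horner_inj => x; rewrite horner_char_poly -pA -(horner_mx_C A)
  -rmorphB.
rewrite (det_horner_mx _ charA) horner_prod.
by apply: eq_bigr => z _; rewrite hornerXsubC -pE hornerD hornerN hornerC.
Qed.

(** * The closed form of beta *)

(** Both sides count the ordered pairs of disjoint subsets of sizes [a] and [b], and vanish when a +
    b > m. *)
Lemma mul_bin_trinomial m a b :
  ('C(m, a) * 'C(m - a, b) = 'C(m, b) * 'C(m - b, a))%N.
Proof.
have [le_ab_m|lt_m_ab] := leqP (a + b) m; last first.
  have [lt_m_a|le_a_m] := ltnP m a.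
    by rewrite (bin_small lt_m_a) (@bin_small _ a) ?muln0 //; lia.
  rewrite (@bin_small _ b) ?muln0; last lia.
  have [lt_m_b|le_b_m] := ltnP m b; first by rewrite (bin_small lt_m_b).
  by rewrite (@bin_small _ a) ?muln0 //; lia.
have pos : (0 < a`! * b`! * (m - a - b)`!)%N by rewrite !muln_gt0 !fact_gt0.
apply/eqP; rewrite -(eqn_pmul2r pos); apply/eqP.
have fa : ('C(m, a) * (a`! * (m - a)`!) = m`!)%N by apply: bin_fact; lia.
have fb : ('C(m, b) * (b`! * (m - b)`!) = m`!)%N by apply: bin_fact; lia.
have fab : ('C(m - a, b) * (b`! * (m - a - b)`!) = (m - a)`!)%N.
  by apply: bin_fact; lia.
have fba : ('C(m - b, a) * (a`! * (m - a - b)`!) = (m - b)`!)%N.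
  by rewrite subnAC; apply: bin_fact; lia.
transitivity m`!; first by rewrite -fa -fab; ring.
by rewrite -fb -fba; ring.
Qed.

Lemma sum_mul_bin_trinomial m p q b :
  (\sum_(t < q.+1) 'C(p, t) * 'C(m, q - t) * 'C(m - (q - t), b)
   = 'C(m, b) * 'C(p + (m - b), q))%N.
Proof.
rewrite -binomial.Vandermonde big_distrr; apply: eq_bigr => t _.
by rewrite -mulnA mul_bin_trinomial mulnCA.
Qed.

(** This is the [s]-th finite difference at [m] of x |-> C(x, b); by Pascal's rule each difference
    lowers [b] by one. *)
Lemma sum_bin_diff s m b : (s <= b)%N ->
  \sum_(r < s.+1) (-1) ^+ (s - r) * 'C(s, r)%:Z * 'C(m + r, b)%:Z
  = 'C(m, b - s)%:Z.
Proof.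
elim: s m b => [|s IHs] m b le_sb.
  by rewrite big_ord1 subn0 bin0 addn0 mulr1 mul1r.
transitivity ('C(m.+1, b - s)%:Z - 'C(m, b - s)%:Z); last first.
  have -> : (b - s = (b - s.+1).+1)%N by lia.
  by rewrite binS; lia.
rewrite -!IHs ?(ltnW le_sb) //.
rewrite big_ord_recl [X in _ - X]big_ord_recl /= !bin0.
under eq_bigr do rewrite /bump /= add1n binS PoszD mulrDr mulrDl subSS.
rewrite big_split /= addrA addrC; congr (_ + _).
  by apply: eq_bigr => r _; rewrite addnS addSn.
rewrite opprD -sumrN !subn0 exprS; congr (_ + _); first ring.
rewrite big_ord_recr /= bin_small // mulr0 mul0r addr0.
apply: eq_bigr => r _; rewrite /bump /= add1n.
have -> : (s - r = (s - r.+1).+1)%N by have := ltn_ord r; lia.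
by rewrite exprS; ring.
Qed.

(** The test keeps a negative lower argument from being truncated to 0, which would give the value
    1. *)
Lemma binz_subz a b c d : (b <= a)%N ->
  binz (a%:Z - b%:Z) (c%:Z - d%:Z) = (if (d <= c)%N then 'C(a - b, c - d)%N
    else 0%N)%:Z.
Proof.
move=> le_ba; rewrite subzn //; case: leqP => [le_dc|lt_cd];
  first by rewrite subzn.
have -> : c%:Z - d%:Z = - (d - c)%N%:Z by lia.
by case: (d - c)%N (subn_gt0 c d) => [|e _ //]; rewrite lt_cd.
Qed.

(* The binomial C(n - 2k + i, n - l) counts the complements of the l-sets
   containing two k-sets that meet in i points. Choosing that complement before
   the second k-set turns the sum over i into a Vandermonde convolution. *)
Lemma sum_johnson_term n k l s r : (r <= s)%N -> (s <= k)%N -> (k <= l)%N ->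
    (k + l <= n)%N ->
  (\sum_((2 * k - l) <= i < k.+1) 'C(n - 2 * k + i, n - l) *
     (if r <= i then 'C(k - r, i - r) else 0) *
     (if i + s <= k + r then 'C(n - k - s + r, k + r - (i + s)) else 0)
   = 'C(n - k - s + r, n - l) * 'C(l - s, k - s))%N.
Proof.
move=> le_rs le_sk le_kl le_kln.
set G := BIG_F; set m := (n - k - s + r)%N.
(* The terms added below 2k - l vanish since n - 2k + i < n - l there. The two conditionals then
   leave r <= i <= k - s + r. *)
have -> : (\sum_(2 * k - l <= i < k.+1) G i = \sum_(0 <= i < k.+1) G i)%N.
  rewrite [RHS](big_cat_nat (leq0n (2 * k - l))) /=; last lia.
  rewrite [X in _ = (X + _)%N]big_nat [X in _ = (X + _)%N]big1 // => i /andP[_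
    lt_i].
  by rewrite /G bin_small //; lia.
rewrite (big_cat_nat (leq0n r)) /=; last lia.
rewrite big_nat big1 ?add0n; last first.
  by move=> i /andP[_ lt_i]; rewrite /G leqNgt lt_i muln0.
rewrite (@big_cat_nat _ _ _ (k - s + r).+1) /=; try lia.
rewrite [X in (_ + X)%N]big_nat [X in (_ + X)%N]big1 ?addn0; last first.
  by move=> i /andP[lt_i _]; rewrite /G [(i + s <= _)%N]leqNgt (_ : (k + r < i
    + s)%N) ?muln0 //; lia.
transitivity ('C(m, n - l) * 'C(k - r + (m - (n - l)), k - s))%N; last first.
  have [lt_m|le_m] := ltnP m (n - l); first by rewrite bin_small.
  by congr (_ * 'C(_, _))%N; rewrite /m; lia.
(* The convolution is used with i = t + r, p = k - r, q = k - s and b = n - l. *)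
rewrite -sum_mul_bin_trinomial -{1}[r]add0n -addSn big_addn addnK big_mkord.
apply: eq_bigr => t _; have lt_t := ltn_ord t.
rewrite /G leq_addl addnK (_ : (t + r + s <= k + r)%N); last lia.
rewrite -mulnA mulnC; congr (_ * 'C(_, _) * 'C(_, _))%N; rewrite /m; lia.
Qed.

Lemma betaE n k l s : (s <= k)%N -> (k <= l)%N -> (k + l <= n)%N ->
  beta n k l s = ('C(l - s, l - k) * 'C(n - k - s, l - k))%N%:Z.
Proof.
move=> le_sk le_kl le_kln; rewrite /beta.
transitivity (\sum_(r < s.+1) (-1) ^+ (s - r) * 'C(s, r)%:Z *
    ('C(n - k - s + r, n - l) * 'C(l - s, k - s))%N%:Z).
  rewrite big_nat.
  under eq_bigr => i /andP[le_i lt_i].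
    have -> : n%:Z - 2 * k%:Z + i%:Z = (n + i)%N%:Z - (2 * k)%N%:Z by lia.
    have -> : l%:Z - 2 * k%:Z + i%:Z = (l + i)%N%:Z - (2 * k)%N%:Z by lia.
    rewrite binz_subz; last lia.
    rewrite (_ : (2 * k <= l + i)%N); last lia.
    rewrite big_distrr big_mkord /=.
    over.
  rewrite -big_nat exchange_big; apply: eq_bigr => r _; have lt_r := ltn_ord r.
  rewrite -sum_johnson_term //; try lia.
  rewrite (big_morph Posz PoszD (erefl _)) big_distrr /= !big_nat.
  apply: eq_bigr => i /andP[le_i lt_i].
  have -> : n%:Z - k%:Z - s%:Z + r%:Z = (n + r)%N%:Z - (k + s)%N%:Z by lia.
  have -> : k%:Z - i%:Z - s%:Z + r%:Z = (k + r)%N%:Z - (i + s)%N%:Z by lia.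
  rewrite !binz_subz; try lia.
  (* The lower index l - 2k + i of beta is complementary to n - l, which is free of i. *)
  rewrite -(@bin_sub _ (n - l)); last lia.
  have -> : (n + i - 2 * k = n - 2 * k + i)%N by lia.
  have -> : (n + r - (k + s) = n - k - s + r)%N by lia.
  have -> : (n - 2 * k + i - (n - l) = l + i - 2 * k)%N by lia.
  by rewrite !PoszM; ring.
under eq_bigr do rewrite PoszM mulrA.
rewrite -big_distrl /= sum_bin_diff; last lia.
rewrite mulnC PoszM; congr (Posz _ * Posz _).
  by rewrite -bin_sub; [congr 'C(_, _) | ]; lia.
by rewrite -bin_sub; [congr 'C(_, _) | ]; lia.
Qed.

(** * Inclusion matrices *)

Definition level (T : finType) (a : nat) : {set {set T}} :=
  [set A : {set T} | #|A| == a].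

Lemma card_level (T : finType) a : #|level T a| = 'C(#|T|, a).
Proof. exact: card_draws. Qed.

Lemma card_enum_level (T : finType) a (i : 'I_#|level T a|) : #|enum_val i| = a.
Proof. by have := enum_valP i; rewrite inE => /eqP. Qed.

(** Adding [A] is a bijection from the subsets of [B :\: A] of size b - |A| onto the sets
    counted. *)
Lemma card_sandwich (T : finType) (A B : {set T}) b :
  #|[set X in level T b | (A \subset X) && (X \subset B)]|
  = if (A \subset B) && (#|A| <= b)%N then 'C(#|B| - #|A|, b - #|A|) else 0%N.
Proof.
case: ifPn => [/andP[sAB le_Ab]|].
  rewrite -(cardsDS sAB) -cards_draws.
  rewrite -(card_in_imset (f := fun X => A :|: X)).
    congr #|pred_of_set _|; apply/setP => X; rewrite !inE.
    apply/andP/imsetP => [[/eqP cX /andP[sAX sXB]]|[Y]].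
      exists (X :\: A); last by rewrite -{1}(setID X A) (setIidPr sAX).
      by rewrite !inE setSD //= cardsDS // cX.
    rewrite inE subsetD => /andP[/andP[sYB dYA] /eqP cY] ->.
    rewrite subsetUl subUset sAB sYB cardsU disjoint_setI0 1?disjoint_sym //.
    by rewrite cards0 subn0 cY subnKC.
  move=> X Y; rewrite !inE !subsetD => /andP[/andP[_ dX] _] /andP[/andP[_ dY]
    _] eqXY.
  have := congr1 (fun Z => Z :\: A) eqXY.
  by rewrite !setDUl setDv !set0U !(setDidPl _).
rewrite negb_and => h; apply/eqP; rewrite cards_eq0; apply/eqP/setP => X.
rewrite !inE; apply/negP => /andP[/eqP cX /andP[sAX sXB]].
by move: h; rewrite (subset_trans sAX sXB) -cX (subset_leq_card sAX).
Qed.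

Definition incl_mx (R : pzRingType) (T : finType) a b :
    'M[R]_(#|level T a|, #|level T b|) :=
  \matrix_(i < #|level T a|, j < #|level T b|) (enum_val i \subset enum_val
    j)%:R.

Lemma sum_level (R : pzRingType) (T : finType) b (P Q : pred {set T}) :
  \sum_(x < #|level T b|) (P (enum_val x))%:R * (Q (enum_val x))%:R
  = #|[set X in level T b | P X && Q X]|%:R :> R.
Proof.
rewrite -(big_enum_val (fun X => (P X)%:R * (Q X)%:R)) -sum1dep_card natr_sum.
rewrite [RHS]big_mkcondr; apply: eq_bigr => X _.
by rewrite -natrM mulnb; case: (_ && _).
Qed.

Lemma incl_mx_id (R : pzRingType) (T : finType) a : incl_mx R T a a = 1%:M.
Proof.
apply/matrixP => i j; rewrite !mxE -(inj_eq enum_val_inj).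
by rewrite eqEcard !card_enum_level leqnn andbT.
Qed.

(** An entry counts the [b]-sets between two given sets, a number that depends only on whether the
    first lies in the second. *)
Lemma incl_mxM (R : pzRingType) (T : finType) a b c :
  incl_mx R T a b *m incl_mx R T b c
  = (if (a <= b)%N then 'C(c - a, b - a) else 0)%:R *: incl_mx R T a c.
Proof.
apply/matrixP => i j; rewrite !mxE.
under eq_bigr do rewrite !mxE.
rewrite (sum_level _ _ (fun X => _ \subset X) (fun X => X \subset _)).
rewrite card_sandwich !card_enum_level.
by case: (_ \subset _); rewrite ?mulr1 ?mulr0.
Qed.

Lemma incl_mxMS (R : pzRingType) (T : finType) a b : (a <= b.+1)%N ->
  incl_mx R T a b *m incl_mx R T b b.+1 = (b.+1 - a)%:R *: incl_mx R T a b.+1.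
Proof.
move=> le_ab; rewrite incl_mxM; congr (_%:R *: _).
by case: leqP => [le|lt]; [rewrite subSn // binSn | lia].
Qed.

Lemma incl_mxSM (R : pzRingType) (T : finType) a c :
  incl_mx R T a a.+1 *m incl_mx R T a.+1 c = (c - a)%:R *: incl_mx R T a c.
Proof. by rewrite incl_mxM leqnSn subSnn bin1. Qed.

Lemma incl_mx_upE (R : pzRingType) (T : finType) a b c
    (i : 'I_#|level T a|) (j : 'I_#|level T c|) :
  (incl_mx R T a b *m (incl_mx R T c b)^T) i j
  = (if (#|enum_val i :|: enum_val j| <= b)%N
     then 'C(#|T| - #|enum_val i :|: enum_val j|, b - #|enum_val i :|: enum_val
       j|)
     else 0)%:R.
Proof.
rewrite !mxE; under eq_bigr do rewrite !mxE.
rewrite (sum_level _ _ (fun X => _ \subset X) (fun X => _ \subset X)).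
have := card_sandwich (enum_val i :|: enum_val j) setT b.
rewrite subsetT cardsT /= => <-; congr (#|pred_of_set _|%:R).
by apply/setP => X; rewrite !inE subsetT andbT subUset.
Qed.

Lemma incl_mx_downE (R : pzRingType) (T : finType) a b c
    (i : 'I_#|level T a|) (j : 'I_#|level T c|) :
  ((incl_mx R T b a)^T *m incl_mx R T b c) i j
  = 'C(#|enum_val i :&: enum_val j|, b)%:R.
Proof.
rewrite !mxE; under eq_bigr do rewrite !mxE.
rewrite (sum_level _ _ (fun X => X \subset _) (fun X => X \subset _)).
rewrite -cards_draws; congr (#|pred_of_set _|%:R).
by apply/setP => X; rewrite !inE subsetI andbC.
Qed.

(** Compare the entries of the two products at (A, B) by the size of [A :\: B]. For size 0 they are
    |T| - c and a + 1, for size 1 both are 1, and beyond that both are 0. *)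
Lemma incl_mx_up_down (R : comNzRingType) (T : finType) a c :
  incl_mx R T a.+1 c.+1 *m (incl_mx R T c c.+1)^T
  = (incl_mx R T a a.+1)^T *m incl_mx R T a c
    + (#|T|%:R - (a + c).+1%:R) *: incl_mx R T a.+1 c.
Proof.
apply/matrixP => i j; rewrite [RHS]mxE incl_mx_upE incl_mx_downE !mxE.
set A := enum_val i; set B := enum_val j.
have cA : #|A| = a.+1 by apply: card_enum_level.
have cB : #|B| = c by apply: card_enum_level.
have le_c : (c <= #|T|)%N by rewrite -cB max_card.
have cI : (#|A :&: B| + #|A :\: B| = a.+1)%N by rewrite cardsID.
have cU : (#|A :|: B| = c + #|A :\: B|)%N by rewrite cardsU cA cB; lia.
rewrite -setD_eq0 -cards_eq0 cU.
case: #|A :\: B| cI => [|[|d]] cI /=.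
- rewrite addn0 leqnSn subSnn bin1 mulr1 (_ : #|A :&: B| = a.+1)%N; last lia.
  by rewrite binSn natrB // -addnS natrD; ring.
- rewrite addn1 leqnn subnn bin0 mulr0 addr0 (_ : #|A :&: B| = a)%N; last lia.
  by rewrite binn.
- rewrite mulr0 addr0 ifF; last lia.
  by rewrite bin_small //; lia.
Qed.

Lemma incl_mx_up_down0 (R : comNzRingType) (T : finType) c :
  incl_mx R T 0 c.+1 *m (incl_mx R T c c.+1)^T
  = (#|T|%:R - c%:R) *: incl_mx R T 0 c.
Proof.
apply/matrixP => i j; rewrite incl_mx_upE !mxE.
have cB : #|enum_val j| = c by apply: card_enum_level.
have /eqP := card_enum_level i; rewrite cards_eq0 => /eqP ->.
have le_c : (c <= #|T|)%N by rewrite -cB max_card.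
by rewrite set0U cB leqnSn subSnn bin1 sub0set mulr1 natrB.
Qed.

(** The operator T_a of the overview; it is zero at level 0, which has no level below. *)
Definition down_up (R : pzRingType) (T : finType) a : 'M[R]_#|level T a| :=
  match a with
  | 0%N => 0
  | b.+1 => (incl_mx R T b b.+1)^T *m incl_mx R T b b.+1
  end.

Lemma up_downE (R : comNzRingType) (T : finType) a :
  incl_mx R T a a.+1 *m (incl_mx R T a a.+1)^T
  = down_up R T a + (#|T|%:R - (2 * a)%:R)%:M.
Proof.
case: a => [|a]; first by rewrite incl_mx_up_down0 incl_mx_id scalemx1 add0r.
rewrite incl_mx_up_down incl_mx_id scalemx1.
by congr (_ + (_ - _%:R)%:M); lia.
Qed.

(** The commutation relation is used once, and the remaining chains of inclusions collapse to scalar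
    multiples. This transports [down_up] from level [c] to level [a] at the cost of a scalar
    shift. *)
Lemma incl_mx_down_up (R : comNzRingType) (T : finType) a c : (a <= c)%N ->
  incl_mx R T a c *m down_up R T c
  = (down_up R T a + ((#|T|.+1%:R - (a + c)%:R) * (c - a)%:R)%:M) *m incl_mx R
    T a c.
Proof.
move=> le_ac; rewrite mulmxDl mul_scalar_mx.
case: a c le_ac => [|a] [|c] // le_ac.
- by rewrite mulmx0 mul0mx subn0 mulr0 scale0r addr0.
- rewrite /= mul0mx add0r mulmxA incl_mx_up_down0 -scalemxAl incl_mxMS //
  scalerA.
  congr (_ *: _); rewrite !subn0 add0n -[#|T|.+1%:R]natr1 -[c.+1%:R]natr1; ring.
rewrite /= mulmxA incl_mx_up_down mulmxDl -!mulmxA -scalemxAl !incl_mxMS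
  ?incl_mxSM //; last exact: leqW.
rewrite scalerA -!scalemxAr subSS subSn //; congr (_ + _ *: _).
rewrite addSn addnS -[#|T|.+1%:R]natr1 -[(a + c).+2%:R]natr1; ring.
Qed.

(* rev puts the newest factor on the left, where the induction produces it. *)
Lemma incl_mx_polynomial (R : comNzRingType) (T : finType) k j :
  (j`! ^ 2)%:R *: (incl_mx R T k (j + k) *m (incl_mx R T k (j + k))^T)
  = \prod_(c <- [seq i.+1%:R * (#|T|%:R - (2 * k + i)%:R) | i <- rev (iota 0
    j)])
      (down_up R T k + c%:M).
Proof.
elim: j => [|j IHj].
  by rewrite incl_mx_id trmx1 mulmx1 big_nil scale1r.
have -> : rev (iota 0 j.+1) = j :: rev (iota 0 j) by rewrite -addn1 iotaD
  rev_cat.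
rewrite map_cons big_cons -IHj.
set W := incl_mx R T k (j + k); set D := incl_mx R T (j + k) (j + k).+1.
have WD : W *m D = j.+1%:R *: incl_mx R T k (j.+1 + k).
  by rewrite incl_mxMS ?leqW ?leq_addl // (_ : ((j + k).+1 - k)%N = j.+1) //;
    lia.
have -> : (j.+1`! ^ 2)%:R *: (incl_mx R T k (j.+1 + k) *m (incl_mx R T k (j.+1
  + k))^T)
    = (j`! ^ 2)%:R *: ((W *m D) *m (W *m D)^T).
  rewrite WD linearZ /= -scalemxAr -scalemxAl !scalerA -!natrM;
    congr (_%:R *: _).
  by rewrite factS expnMn; ring.
rewrite trmx_mul mulmxA -[W *m D *m _]mulmxA up_downE mulmxDr scalar_mxC.
rewrite incl_mx_down_up ?leq_addl // -/W addnK -mulmxDl -mulmxA.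
(* With n = |T|, the shifts add up: (n + 1 - 2k - j) j + (n - 2k - 2j) = (j + 1)(n - 2k - j). *)
rewrite -addrA -raddfD -[RHS]scalemxAr; congr (_ *: ((_ + _%:M) *m _)).
ring.
Qed.

(** * The spectrum *)

(** Count the pairs of a [k]-set inside an [l]-set in two ways, and compare C(l, l - k) with C(n -
    k, l - k), where l <= n - k. *)
Lemma leq_bin_sym n k l : (k <= l)%N -> (k + l <= n)%N -> ('C(n, k) <= 'C(n,
  l))%N.
Proof.
move=> le_kl le_kln.
have pos : (0 < 'C(l, k))%N by rewrite bin_gt0.
rewrite -(leq_pmul2r pos).
have -> : ('C(n, l) * 'C(l, k) = 'C(n, k) * 'C(n - k, n - l))%N.
  by rewrite mul_bin_trinomial bin_sub ?subKn //; lia.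
rewrite leq_mul2l -(@bin_sub (n - k)); last lia.
by rewrite -(bin_sub le_kl) (_ : n - k - (n - l) = l - k)%N ?leq_bin2l ?orbT;
  lia.
Qed.

Lemma prod_flatten_nseq (R : comPzSemiRingType) (I J : Type) (r : seq I)
    (m : I -> nat) (v : I -> J) (F : J -> R) :
  \prod_(z <- flatten [seq nseq (m s) (v s) | s <- r]) F z
  = \prod_(s <- r) F (v s) ^+ m s.
Proof.
rewrite big_flatten big_map; apply: eq_bigr => s _.
by rewrite big_nseq iter_mulr_1.
Qed.

Lemma char_poly_down_up (R : idomainType) (T : finType) a : (2 * a <= #|T|)%N ->
  char_poly (down_up R T a)
  = \prod_(0 <= s < a.+1)
      ('X - ((a - s) * (#|T|.+1 - s - a))%N%:R%:P) ^+ mult #|T| s.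
Proof.
set n := #|T|; elim: a => [|a IHa] le_an.
  rewrite big_nat1 mul0n subr0 /mult bin0 subn0.
  by rewrite /char_poly /char_poly_mx map_mx0 subr0 det_scalar card_level bin0.
have le_bin : ('C(n, a) <= 'C(n, a.+1))%N by apply: leq_bin_sym; lia.
have Xn_neq0 : 'X^('C(n, a)) != 0 :> {poly R} by rewrite expf_eq0 polyX_eq0
  andbF.
apply: (mulfI Xn_neq0).
rewrite -{1}card_level /= -char_poly_mulmxC up_downE char_poly_addC card_level.
rewrite IHa; last lia.
rewrite rmorph_prod /=.
(* The new eigenvalue, for s = a + 1, is 0; its multiplicity raises the exponent C(n, a) of ['X] to
   C(n, a + 1). *)
rewrite [in RHS]big_nat_recr //= subnn mul0n subr0 mulrCA -exprD mulrC.
rewrite [(_ + mult _ _)%N]subnKC //; congr (_ * _).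
apply: eq_big_nat => s /andP[_ lt_s]; rewrite rmorphXn /= comp_polyB comp_polyX
  comp_polyC.
rewrite -addrA -opprD -polyCD -(@natrB _ n (2 * a)); last lia.
rewrite -natrD; congr (('X - _%:R%:P) ^+ _).
(* With u = a - s and v = n - 2a the claim is u(v + u + 1) + v = (u + 1)(v + u). *)
rewrite (_ : n.+1 - s - a = n - 2 * a + (a - s) + 1)%N; last lia.
rewrite (_ : n.+1 - s - a.+1 = n - 2 * a + (a - s))%N; last lia.
by rewrite subSn //; ring.
Qed.

(** List all [k]-sets before all [l]-sets. The diagonal blocks vanish because sets of equal size are
    comparable only when equal. *)
Lemma char_poly_incl_adj (C : numClosedFieldType) n k l : (k < l)%N ->
  char_poly (adjacency_mx C (@incl_adj n k l))
  = char_poly (block_mx 0 (incl_mx C 'I_n k l) (incl_mx C 'I_n k l)^T 0).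
Proof.
move=> lt_kl.
pose g (i : 'I_(#|level 'I_n k| + #|level 'I_n l|)) : {set 'I_n} :=
  match split i with inl a => enum_val a | inr b => enum_val b end.
have gl a : g (lshift _ a) = enum_val a by rewrite /g (unsplitK (inl _)).
have gr b : g (rshift _ b) = enum_val b by rewrite /g (unsplitK (inr _)).
have gP i : (#|g i| == k) || (#|g i| == l).
  by case: (split_ordP i) => a ->; rewrite ?gl ?gr card_enum_level eqxx ?orbT.
pose f i : incl_vertex n k l := Sub (g i) (gP i).
have neq_kl (A B : {set 'I_n}) : #|A| = k -> #|B| = l -> (A == B) = false.
  by move=> cA cB; apply/eqP => eqAB; move: cB lt_kl; rewrite -eqAB cA => ->;
    rewrite ltnn.
have sub_eq a (i j : 'I_#|level 'I_n a|) : (enum_val i \subset enum_val j) = (i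
  == j).
  by rewrite -(inj_eq enum_val_inj) eqEcard !card_enum_level leqnn andbT.
have g_inj : injective g.
  move=> i j; case: (split_ordP i) => a ->; case: (split_ordP j) => b ->;
    rewrite ?gl ?gr => /eqP.
  - by rewrite (inj_eq enum_val_inj) => /eqP ->.
  - by rewrite neq_kl ?card_enum_level.
  - by rewrite eq_sym neq_kl ?card_enum_level.
  - by rewrite (inj_eq enum_val_inj) => /eqP ->.
have f_inj : injective f by move=> i j /(congr1 val) /g_inj.
have f_bij : bijective f.
  (* Surjectivity follows by counting: the vertices lie in the union of the two levels. *)
  apply: inj_card_bij f_inj _; rewrite card_sig card_ord.
  rewrite -cardsUI; apply: leq_trans (leq_addr _ _).
  by apply/subset_leq_card/subsetP => A; rewrite !inE.
rewrite (char_poly_matrix_bij (fun u v => (incl_adj u v)%:R) f_bij).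
congr char_poly; apply/matrixP => i j; rewrite mxE /incl_adj (inj_eq f_inj) /=.
case: (split_ordP i) => a ->; case: (split_ordP j) => b ->.
- by rewrite block_mxEul mxE !gl (inj_eq (@lshift_inj _ _)) !sub_eq eq_sym orbb
  andNb.
- rewrite block_mxEur mxE gl gr eq_lrshift /=; congr (_%:R).
  rewrite [X in _ || X](_ : _ = false) ?orbF //; apply/negP => /subset_leq_card.
  by rewrite !card_enum_level leqNgt lt_kl.
- rewrite block_mxEdl !mxE gl gr eq_rlshift /=; congr (_%:R).
  rewrite [X in X || _](_ : _ = false) //; apply/negP => /subset_leq_card.
  by rewrite !card_enum_level leqNgt lt_kl.
- by rewrite block_mxEdr mxE !gr (inj_eq (@rshift_inj _ _)) !sub_eq eq_sym orbb
  andNb.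
Qed.

(** Each factor splits as (k - s)(n + 1 - s - k) + (i + 1)(n - 2k - i) = (k - s + i + 1)(n - k - s -
    i). The product is thus two falling factorials of length [j], and dividing by (j!)^2 makes them
    the binomials of [betaE]. *)
Lemma prod_eigenvalue_shifts (C : numClosedFieldType) (n k j s : nat) :
  (s <= k)%N -> (2 * k + j <= n)%N ->
  (j`! ^ 2)%:R^-1 * \prod_(c <- [seq i.+1%:R * (n%:R - (2 * k + i)%:R) | i <-
    rev (iota 0 j)])
     (((k - s) * (n.+1 - s - k))%:R + c)
  = (beta n k (j + k) s)%:~R :> C.
Proof.
move=> le_sk le_n; rewrite betaE ?leq_addl //; last lia.
rewrite addnK big_map (perm_big (iota 0 j)) ?perm_rev //=.
rewrite -pmulrn; apply: (mulfI (x := (j`! ^ 2)%:R)).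
  by rewrite pnatr_eq0 -lt0n expn_gt0 fact_gt0.
rewrite mulrA divff ?mul1r; last by rewrite pnatr_eq0 -lt0n expn_gt0 fact_gt0.
rewrite -natrM (_ : (j`! ^ 2 * _)%N = ((k - s + j) ^_ j * (n - k - s) ^_ j)%N).
  2:{ rewrite -!bin_ffact (_ : k - s + j = j + k - s)%N; [ring | lia]. }
elim: j le_n => [|j IHj] le_n; first by rewrite big_nil.
rewrite -[j.+1]addn1 iotaD big_cat big_seq1 /= IHj; last lia.
rewrite add0n addn1 addnS ffactSS ffactnSr -(@natrB _ n (2 * k + j)); last lia.
rewrite -!(natrM, natrD); congr (_%:R).
rewrite (_ : n.+1 - s - k = n - (2 * k + j) + (k - s) + j.+1)%N; last lia.
by rewrite (_ : n - k - s - j = n - (2 * k + j) + (k - s))%N; [ring | lia].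
Qed.

Theorem theorem1p1 (C : numClosedFieldType) (n k l : nat)
    (hk : (1 <= k)%N) (hkl : (k < l)%N) (hln : (l <= n - 1)%N)
    (hsum : (k + l <= n)%N) :
  perm_eq (spectrum (adjacency_mx C (@incl_adj n k l)))
    (flatten [seq nseq (mult n s) (sqrtC (beta n k l s)%:~R)
                  ++ nseq (mult n s) (- sqrtC (beta n k l s)%:~R)
             | s <- iota 0 k.+1]
     ++ nseq ('C(n, l) - 'C(n, k)) 0).
Proof.
apply: prod_XsubC_eq; rewrite -char_poly_spectrum char_poly_incl_adj //.
set W := incl_mx C 'I_n k l.
have Xn_neq0 : 'X^('C(n, k)) != 0 :> {poly C} by rewrite expf_eq0 polyX_eq0
  andbF.
have card_lev a : #|level 'I_n a| = 'C(n, a) by rewrite card_level card_ord.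
have charW : char_poly (W *m W^T) =
    \prod_(s <- iota 0 k.+1) ('X - (beta n k l s)%:~R%:P) ^+ mult n s.
  have [j lE] : exists j, l = (j + k)%N by exists (l - k)%N; lia.
  rewrite /W lE.
  have jf_neq0 : (j`! ^ 2)%:R != 0 :> C by rewrite pnatr_eq0 -lt0n expn_gt0
    fact_gt0.
  rewrite -[_ *m _](scalerK jf_neq0) incl_mx_polynomial card_ord.
  have charT := @char_poly_down_up C 'I_n k; rewrite card_ord in charT.
  have {charT} := charT _; rewrite /index_iota subn0.
  rewrite -(prod_flatten_nseq _ _ _ (fun z => 'X - z%:P)) => charT.
  rewrite (char_poly_prod_shifts _ _ (charT _)); last lia.
  rewrite (prod_flatten_nseq _ _ _ (fun z => 'X - (_ * \prod_(c <- _) (z +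
    c))%:P)).
  rewrite big_seq [RHS]big_seq; apply: eq_bigr => s;
    rewrite mem_iota => /andP[_ lt_s].
  by rewrite prod_eigenvalue_shifts //; lia.
(* The C(n, l) - C(n, k) zeros of the claimed spectrum complete ['X^('C(n, k))] to the power C(n, l)
   produced by [char_poly_antidiag]. *)
apply: (mulfI Xn_neq0).
rewrite -{1}card_lev char_poly_antidiag charW card_lev big_cat big_nseq
  iter_mulr_1.
rewrite polyC0 subr0 mulrCA -exprD subnKC ?leq_bin_sym ?(ltnW hkl) // mulrC;
  congr (_ * _).
rewrite rmorph_prod big_flatten big_map; apply: eq_bigr => s _ /=.
rewrite rmorphXn /= comp_polyB comp_polyX comp_polyC.
rewrite big_cat !big_nseq !iter_mulr_1 /= -exprMn; congr (_ ^+ _).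
(* Each factor X^2 - beta_s splits into the two linear factors of the square roots of beta_s. *)
by rewrite polyCN opprK -subr_sqr -rmorphXn /= sqrtCK.
Qed.
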